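(* There is an absolute constant $C$ such that the following holds. Let $X\subset\mathbb{R}^{d_1}$ and $Y\subset\mathbb{R}^{d_2}$ be convex compact sets containing the origin with $\max_{x\in X}\|x\|_2\le D$ and $\max_{y\in Y}\|y\|_2\le D$ for some $D>0$. Let $T\ge2$ and let $\bar{\mathcal{L}}_1,\dots,\bar{\mathcal{L}}_T:X\times Y\to\mathbb{R}$ be convex-concave functions, each $G_{\bar{\mathcal{L}}}$-Lipschitz with respect to $\|\cdot\|_2$, where $G_{\bar{\mathcal{L}}}>0$. Let $R_X(x)=\|x\|_2^2$, $R_Y(y)=\|y\|_2^2$ and $\eta=\frac{D\sqrt T}{G_{\bar{\mathcal{L}}}\sqrt{\ln T}}$. Then the iterates $(x_t,y_t)$ of the algorithm SP-RFTL with parameters $\eta,R_X,R_Y$ run on this sequence satisfy $$\Bigl|\sum_{t=1}^T\bar{\mathcal{L}}_t(x_t,y_t)-\min_{x\in X}\max_{y\in Y}\sum_{t=1}^T\bar{\mathcal{L}}_t(x,y)\Bigr|\le C\,G_{\bar{\mathcal{L}}}D\sqrt{T\ln T}.$$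
   Context: Convex-concave: convex in $x\in X$ for each fixed $y\in Y$ and concave in $y\in Y$ for each fixed $x\in X$. $G$-Lipschitz w.r.t. $\|\cdot\|_2$: $|\mathcal{L}(x_1,y_1)-\mathcal{L}(x_2,y_2)|\le G\|[x_1;y_1]-[x_2;y_2]\|_2$, where $[x;y]$ denotes concatenation. SP-RFTL (Saddle-Point Regularized-Follow-the-Leader) with parameters $\eta>0$, $R_X,R_Y$: start with arbitrary $x_1\in X$, $y_1\in Y$; for $t\ge1$, after $\bar{\mathcal{L}}_t$ is revealed, put $\mathcal{L}_t(x,y)=\bar{\mathcal{L}}_t(x,y)+\frac1\eta R_X(x)-\frac1\eta R_Y(y)$ and set $x_{t+1}=\arg\min_{x\in X}\max_{y\in Y}\sum_{\tau=1}^t\mathcal{L}_\tau(x,y)$, $y_{t+1}=\arg\max_{y\in Y}\min_{x\in X}\sum_{\tau=1}^t\mathcal{L}_\tau(x,y)$. *)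

(* Defs.v *)
From mathcomp Require Import all_boot all_order all_algebra.
From mathcomp Require Import all_classical all_reals all_analysis.

Set Implicit Arguments.
Unset Strict Implicit.
Unset Printing Implicit Defensive.

Import Order.TTheory GRing.Theory Num.Theory.
Import numFieldNormedType.Exports.

Local Open Scope classical_set_scope.
Local Open Scope ring_scope.

(* The library norm [`|x|] on ['rV[R]_d] is the sup norm, hence this one; the
   library topology on ['rV[R]_d] is the usual one. *)
Definition l2norm (R : realType) (d : nat) (x : 'rV[R]_d) : R :=
  Num.sqrt (\sum_(i < d) x 0 i ^+ 2).

(* The greatest and least values of [f] on [A]; the default 0 is returned only
   when the extremum is not attained, which [max_overP] and [min_overP] exclude
   for a continuous [f] on a nonempty compact [A]. *)
Definition max_over (R : realType) (T : Type) (A : set T) (f : T -> R) : R :=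
  xget 0 [set m | (f @` A) m /\ ubound (f @` A) m].

Definition min_over (R : realType) (T : Type) (A : set T) (f : T -> R) : R :=
  xget 0 [set m | (f @` A) m /\ lbound (f @` A) m].

Definition argmin (R : realType) (T : Type) (A : set T) (f : T -> R) : set T :=
  [set a | A a /\ forall b, A b -> f a <= f b].

Definition argmax (R : realType) (T : Type) (A : set T) (f : T -> R) : set T :=
  [set a | A a /\ forall b, A b -> f b <= f a].

Lemma max_overP (R : realType) (T : topologicalType) (A : set T) (f : T -> R) :
  A !=set0 -> compact A -> {within A, continuous f} ->
  (f @` A) (max_over A f) /\ ubound (f @` A) (max_over A f).
Proof.
move=> A0 cA cf; have [c cA' fc] := compact_EVT_max A0 cA cf.
apply: (@xgetPex _ 0 [set m | (f @` A) m /\ ubound (f @` A) m]).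
exists (f c); split; first by exists c => //; exact: set_mem.
by move=> _ [t At <-]; apply: fc; exact: mem_set.
Qed.

Lemma min_overP (R : realType) (T : topologicalType) (A : set T) (f : T -> R) :
  A !=set0 -> compact A -> {within A, continuous f} ->
  (f @` A) (min_over A f) /\ lbound (f @` A) (min_over A f).
Proof.
move=> A0 cA cf; have [c cA' fc] := compact_EVT_min A0 cA cf.
apply: (@xgetPex _ 0 [set m | (f @` A) m /\ lbound (f @` A) m]).
exists (f c); split; first by exists c => //; exact: set_mem.
by move=> _ [t At <-]; apply: fc; exact: mem_set.
Qed.

(* A function on [X * Y] is a total function of two arguments of which only the
   values on [X * Y] are constrained or used. *)
Definition convex_concave (R : realType) (d1 d2 : nat)
    (X : set 'rV[R]_d1) (Y : set 'rV[R]_d2)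
    (L : 'rV[R]_d1 -> 'rV[R]_d2 -> R) : Prop :=
  (forall y, Y y -> convex_function X (fun x => L x y)) /\
  (forall x, X x -> convex_function Y (fun y => - L x y)).

Definition l2_lipschitz (R : realType) (d1 d2 : nat)
    (X : set 'rV[R]_d1) (Y : set 'rV[R]_d2) (G : R)
    (L : 'rV[R]_d1 -> 'rV[R]_d2 -> R) : Prop :=
  forall x1 y1 x2 y2, X x1 -> Y y1 -> X x2 -> Y y2 ->
    `|L x1 y1 - L x2 y2| <= G * l2norm (row_mx x1 y1 - row_mx x2 y2).

Definition regularized (R : realType) (d1 d2 : nat) (eta : R)
    (RX : 'rV[R]_d1 -> R) (RY : 'rV[R]_d2 -> R)
    (Lbar : 'rV[R]_d1 -> 'rV[R]_d2 -> R) (x : 'rV[R]_d1) (y : 'rV[R]_d2) : R :=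
  Lbar x y + eta^-1 * RX x - eta^-1 * RY y.

(* [(x 1, y 1), ..., (x T, y T)] are the first [T] iterates of SP-RFTL run on
   [Lbar 1, Lbar 2, ...]; the values of [x] and [y] at 0 and beyond [T], and
   those of [Lbar] at 0 and from [T] on, are irrelevant. *)
Definition sp_rftl (R : realType) (d1 d2 : nat)
    (X : set 'rV[R]_d1) (Y : set 'rV[R]_d2) (eta : R)
    (RX : 'rV[R]_d1 -> R) (RY : 'rV[R]_d2 -> R) (T : nat)
    (Lbar : nat -> 'rV[R]_d1 -> 'rV[R]_d2 -> R)
    (x : nat -> 'rV[R]_d1) (y : nat -> 'rV[R]_d2) : Prop :=
  [/\ X (x 1%N), Y (y 1%N) &
    forall t : nat, (1 <= t < T)%N ->
      let S u v := \sum_(1 <= s < t.+1) regularized eta RX RY (Lbar s) u v in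
      argmin X (fun u => max_over Y (fun v => S u v)) (x t.+1) /\
      argmax Y (fun v => min_over X (fun u => S u v)) (y t.+1)].

(* Main.v *)
(* Put c = 1/eta. The iterate (x_{t+1}, y_{t+1}) is the saddle point of
   F_t = sum_{s <= t} L_s, where L_s = Lbar_s + c (|u|^2 - |v|^2); write V_t for
   the saddle value. Comparing consecutive saddle points with one coordinate
   changed at a time gives
     sum_t L_t(x_{t+1}, y_t) <= V_T <= sum_t L_t(x_t, y_{t+1}).
   Each L_t is K-Lipschitz with K = G + 2 D c, and F_t is strongly
   convex-concave with modulus of order t c, so consecutive iterates are
   O(K / (t c)) apart; hence sum_t L_t(x_t, y_t) and V_T differ by
   O(K^2 / c) (1 + 1/2 + ... + 1/T). Removing the regularizer costs at most
   T c D^2 on either side, and the given eta balances the two errors. *)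

Require Import Defs.
From mathcomp Require Import all_boot all_order all_algebra.
From mathcomp Require Import all_classical all_reals all_analysis.
From mathcomp Require Import ring lra zify.

Set Implicit Arguments.
Unset Strict Implicit.
Unset Printing Implicit Defensive.

Import Order.TTheory GRing.Theory Num.Theory.
Import numFieldNormedType.Exports.

Local Open Scope classical_set_scope.
Local Open Scope ring_scope.

(** * The Euclidean norm *)

Lemma sqr_l2norm (R : realType) (d : nat) (a : 'rV[R]_d) :
  l2norm a ^+ 2 = \sum_(i < d) a 0 i ^+ 2.
Proof. by rewrite sqr_sqrtr // sumr_ge0 // => i _; exact: sqr_ge0. Qed.

Lemma l2norm_ge0 (R : realType) (d : nat) (a : 'rV[R]_d) : 0 <= l2norm a.
Proof. exact: sqrtr_ge0. Qed.

Lemma l2norm0 (R : realType) (d : nat) : l2norm (0 : 'rV[R]_d) = 0.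
Proof.
apply/eqP; rewrite -sqrf_eq0 sqr_l2norm big1 // => i _.
by rewrite mxE expr0n.
Qed.

Lemma l2normB (R : realType) (d : nat) (a b : 'rV[R]_d) :
  l2norm (a - b) = l2norm (b - a).
Proof.
by congr Num.sqrt; apply: eq_bigr => i _; rewrite !mxE -sqrrN opprB.
Qed.

Lemma l2norm_eq0 (R : realType) (d : nat) (a : 'rV[R]_d) :
  l2norm a = 0 -> a = 0.
Proof.
move=> a0; apply/rowP => i; rewrite mxE; apply/eqP; rewrite -sqrf_eq0.
have /eqP := sqr_l2norm a; rewrite a0 expr0n eq_sym psumr_eq0; last first.
  by move=> j _; exact: sqr_ge0.
by move=> /allP /(_ i); rewrite mem_index_enum; apply.
Qed.

(** With p = |a| |b|, expanding the sum of the squares (|b| a_i - |a| b_i)^2 gives 0 <= 2 p^2 - 2 p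
    <a, b>, and p can be cancelled once the zero vectors are set aside. *)
Lemma l2norm_cauchy_schwarz (R : realType) (d : nat) (a b : 'rV[R]_d) :
  \sum_(i < d) a 0 i * b 0 i <= l2norm a * l2norm b.
Proof.
have [a0|a0] := eqVneq (l2norm a) 0.
  by rewrite a0 mul0r (l2norm_eq0 a0) big1 // => i _; rewrite mxE mul0r.
have [b0|b0] := eqVneq (l2norm b) 0.
  by rewrite b0 mulr0 (l2norm_eq0 b0) big1 // => i _; rewrite mxE mulr0.
have pq_gt0 : 0 < l2norm a * l2norm b.
  by rewrite mulr_gt0 // lt0r ?a0 ?b0 l2norm_ge0.
have : 0 <= \sum_(i < d) (l2norm b * a 0 i - l2norm a * b 0 i) ^+ 2.
  by apply: sumr_ge0 => i _; exact: sqr_ge0.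
under eq_bigr => i _.
  rewrite (_ : (_ - _) ^+ 2 = l2norm b ^+ 2 * a 0 i ^+ 2
    + l2norm a ^+ 2 * b 0 i ^+ 2
    - 2 * (l2norm a * l2norm b) * (a 0 i * b 0 i)); last by ring.
  over.
rewrite sumrB big_split /= -!mulr_sumr -!sqr_l2norm.
set S := \sum_(i < d) _; move=> h.
rewrite -(ler_pM2l pq_gt0); nra.
Qed.

(** The subtracted term is the source of all the strong convexity below. *)
Lemma sqr_l2norm_conv (R : realType) (d : nat) (t : R) (a b : 'rV[R]_d) :
  l2norm (t *: a + (1 - t) *: b) ^+ 2
  = t * l2norm a ^+ 2 + (1 - t) * l2norm b ^+ 2
    - t * (1 - t) * l2norm (a - b) ^+ 2.
Proof.
rewrite !sqr_l2norm !mulr_sumr -big_split -sumrB /=.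
by apply: eq_bigr => i _; rewrite !mxE; ring.
Qed.

Lemma sqr_l2norm_parallelogram (R : realType) (d : nat) (a b : 'rV[R]_d) :
  l2norm (a + b) ^+ 2 + l2norm (a - b) ^+ 2
  = 2 * l2norm a ^+ 2 + 2 * l2norm b ^+ 2.
Proof.
rewrite !sqr_l2norm !mulr_sumr -!big_split /=.
by apply: eq_bigr => i _; rewrite !mxE; ring.
Qed.

(** The parallelogram law stands in for the triangle inequality. *)
Lemma l2normD_le (R : realType) (d : nat) (D : R) (a b : 'rV[R]_d) :
  l2norm a <= D -> l2norm b <= D -> l2norm (a + b) <= 2 * D.
Proof.
move=> aD bD; have D0 : 0 <= D := le_trans (l2norm_ge0 a) aD.
have := sqr_l2norm_parallelogram a b; have := sqr_ge0 (l2norm (a - b)).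
have : l2norm a ^+ 2 <= D ^+ 2 by rewrite lerXn2r ?nnegrE ?l2norm_ge0.
have : l2norm b ^+ 2 <= D ^+ 2 by rewrite lerXn2r ?nnegrE ?l2norm_ge0.
move=> h1 h2 h3 h4.
by rewrite -(@ler_pXn2r _ 2) ?nnegrE ?l2norm_ge0 ?mulr_ge0 //; lra.
Qed.

Lemma sqr_l2norm_lipschitz (R : realType) (d : nat) (D : R) (a b : 'rV[R]_d) :
  l2norm a <= D -> l2norm b <= D ->
  `|l2norm a ^+ 2 - l2norm b ^+ 2| <= 2 * D * l2norm (a - b).
Proof.
wlog suff main : a b / l2norm a <= D -> l2norm b <= D ->
    l2norm a ^+ 2 - l2norm b ^+ 2 <= 2 * D * l2norm (a - b).
  move=> aD bD; rewrite ler_norml main // andbT lerNl opprB l2normB.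
  exact: main.
move=> aD bD; have abD := l2normD_le aD bD.
have -> : l2norm a ^+ 2 - l2norm b ^+ 2
    = \sum_(i < d) (a + b) 0 i * (a - b) 0 i.
  rewrite !sqr_l2norm -sumrB; apply: eq_bigr => i _; rewrite !mxE; ring.
apply: le_trans (l2norm_cauchy_schwarz _ _) _.
by rewrite ler_wpM2r // l2norm_ge0.
Qed.

Lemma l2norm_row_mx_le (R : realType) (d1 d2 : nat)
    (a : 'rV[R]_d1) (b : 'rV[R]_d2) :
  l2norm (row_mx a b) <= l2norm a + l2norm b.
Proof.
have a0 := l2norm_ge0 a; have b0 := l2norm_ge0 b.
rewrite -(@ler_pXn2r _ 2) ?nnegrE ?l2norm_ge0 ?addr_ge0 //.
rewrite sqr_l2norm big_split_ord /=.
under eq_bigr do rewrite row_mxEl.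
under [X in _ + X]eq_bigr do rewrite row_mxEr.
rewrite -!sqr_l2norm; nra.
Qed.

(** The topology comes from the sup norm; this comparison turns Euclidean Lipschitz bounds into
    continuity. *)
Lemma l2norm_le_norm (R : realType) (d : nat) (a : 'rV[R]_d) :
  l2norm a <= Num.sqrt d%:R * `|a|.
Proof.
rewrite -(@ler_pXn2r _ 2) ?nnegrE ?l2norm_ge0 ?mulr_ge0 ?sqrtr_ge0 //.
rewrite sqr_l2norm exprMn sqr_sqrtr ?ler0n //.
rewrite mulr_natl -[X in _ *+ X]card_ord -sumr_const; apply: ler_sum => i _.
rewrite -[leLHS]real_normK ?num_real // lerXn2r ?nnegrE ?normr_ge0 //.
rewrite [leRHS]/Num.norm /= mx_normrE.
exact: (@le_bigmax _ _ _ _ (fun p => `|a p.1 p.2|) (ord0, i)).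
Qed.

(** * Continuity, convexity and growth around minimizers *)

Lemma l2_lipschitz_within_continuous (R : realType) (d : nat)
    (A : set 'rV[R]_d) (K : R) (f : 'rV[R]_d -> R) : 0 <= K ->
  (forall a b, A a -> A b -> `|f a - f b| <= K * l2norm (a - b)) ->
  {within A, continuous f}.
Proof.
move=> K0 fK; apply/subspace_continuousP => a Aa.
apply/cvgrPdist_lt => e e0.
have Kd0 : 0 <= K * Num.sqrt d%:R by rewrite mulr_ge0 ?sqrtr_ge0.
(* The added 1 keeps the radius well defined when [K] or [d] is 0. *)
have K1 : 0 < K * Num.sqrt d%:R + 1 by rewrite ltr_wpDl.
have := @nbhsx_ballx _ _ a _ (divr_gt0 e0 K1).
rewrite -ball_normE /= => nb; rewrite near_withinE; near=> b => Ab.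
have ab : `|a - b| < e / (K * Num.sqrt d%:R + 1) by near: b; exact: nb.
apply: le_lt_trans (fK _ _ Aa Ab) _.
apply: (@le_lt_trans _ _ (K * Num.sqrt d%:R * `|a - b|)).
  by rewrite -mulrA ler_wpM2l ?l2norm_le_norm.
move: ab; rewrite ltr_pdivlMr // => ab.
by have := normr_ge0 (a - b); nra.
Unshelve. all: by end_near.
Qed.

Lemma convex_set_conv (R : realType) (d : nat) (A : set 'rV[R]_d) (t : R) a b :
  convex_set A -> 0 <= t -> t <= 1 -> A a -> A b ->
  A (t *: a + (1 - t) *: b).
Proof.
move=> cA t0 t1 Aa Ab.
have := cA a b (Itv01 t0 t1); rewrite !inE; exact.
Qed.

Lemma convex_function_conv (R : realType) (d : nat) (A : set 'rV[R]_d)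
    (f : 'rV[R]_d -> R) (t : R) a b :
  convex_function A f -> 0 <= t -> t <= 1 -> A a -> A b ->
  f (t *: a + (1 - t) *: b) <= t * f a + (1 - t) * f b.
Proof.
move=> cf t0 t1 Aa Ab.
have := cf (Itv01 t0 t1) a b; rewrite !inE; exact.
Qed.

(* Comparing [a] with the midpoint of [a] and [b] loses a factor 2 against the
   optimal constant [c], but needs no limit. *)
Lemma strongly_convex_argmin (R : realType) (d : nat) (A : set 'rV[R]_d)
    (h : 'rV[R]_d -> R) (c : R) (a : 'rV[R]_d) :
  convex_set A -> convex_function A h ->
  argmin A (fun u => h u + c * l2norm u ^+ 2) a ->
  forall b, A b ->
  c / 2 * l2norm (b - a) ^+ 2
  <= h b + c * l2norm b ^+ 2 - (h a + c * l2norm a ^+ 2).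
Proof.
move=> cA ch [Aa amin] b Ab.
have t0 : 0 <= 2^-1 :> R by lra.
have t1 : 2^-1 <= 1 :> R by lra.
have := amin _ (convex_set_conv cA t0 t1 Ab Aa).
rewrite sqr_l2norm_conv.
have := convex_function_conv ch t0 t1 Ab Aa.
set m := h (_ + _); move: (l2norm _ ^+ 2) (l2norm _ ^+ 2) (l2norm _ ^+ 2).
move=> p q r h1 h2; lra.
Qed.

(** * Saddle points of ridge-regularized games *)

Definition saddle_point (T U : Type) (R : realType) (X : set T) (Y : set U)
    (f : T -> U -> R) (a : T) (b : U) : Prop :=
  argmin X (fun u => f u b) a /\ argmax Y (fun v => f a v) b.

(** A sum of two norms, instead of the norm of the concatenation, lets each player's move be charged
    separately. *)
Definition sum_lipschitz (R : realType) (d1 d2 : nat)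
    (X : set 'rV[R]_d1) (Y : set 'rV[R]_d2) (K : R)
    (f : 'rV[R]_d1 -> 'rV[R]_d2 -> R) : Prop :=
  forall x1 y1 x2 y2, X x1 -> Y y1 -> X x2 -> Y y2 ->
    `|f x1 y1 - f x2 y2| <= K * (l2norm (x1 - x2) + l2norm (y1 - y2)).

Lemma sum_lipschitzl (R : realType) (d1 d2 : nat)
    (X : set 'rV[R]_d1) (Y : set 'rV[R]_d2) (K : R) f y :
  sum_lipschitz X Y K f -> Y y ->
  forall x1 x2, X x1 -> X x2 -> `|f x1 y - f x2 y| <= K * l2norm (x1 - x2).
Proof.
move=> fK Yy x1 x2 Xx1 Xx2; apply: le_trans (fK _ _ _ _ Xx1 Yy Xx2 Yy) _.
by rewrite subrr l2norm0 addr0.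
Qed.

Lemma sum_lipschitzr (R : realType) (d1 d2 : nat)
    (X : set 'rV[R]_d1) (Y : set 'rV[R]_d2) (K : R) f x :
  sum_lipschitz X Y K f -> X x ->
  forall y1 y2, Y y1 -> Y y2 -> `|f x y1 - f x y2| <= K * l2norm (y1 - y2).
Proof.
move=> fK Xx y1 y2 Yy1 Yy2; apply: le_trans (fK _ _ _ _ Xx Yy1 Xx Yy2) _.
by rewrite subrr l2norm0 add0r.
Qed.

(** A maximizer at [x1] is a competitor at [x2]. The resulting continuity ensures that the outer
    minimum is attained. *)
Lemma max_over_lipschitz (R : realType) (d1 d2 : nat)
    (X : set 'rV[R]_d1) (Y : set 'rV[R]_d2) (K : R) f :
  0 <= K -> compact Y -> Y !=set0 -> sum_lipschitz X Y K f ->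
  forall x1 x2, X x1 -> X x2 ->
  `|max_over Y (f x1) - max_over Y (f x2)| <= K * l2norm (x1 - x2).
Proof.
move=> K0 cY Y0 fK.
wlog suff main : / forall x1 x2, X x1 -> X x2 ->
    max_over Y (f x1) - max_over Y (f x2) <= K * l2norm (x1 - x2).
  move=> x1 x2 Xx1 Xx2; rewrite ler_norml main // andbT lerNl opprB l2normB.
  exact: main.
move=> x1 x2 Xx1 Xx2.
have maxP x : X x -> _ := fun Xx => max_overP Y0 cY
  (l2_lipschitz_within_continuous K0 (sum_lipschitzr fK Xx)).
have [[v1 Yv1 <-] _] := maxP _ Xx1.
have [_ ub2] := maxP _ Xx2.
have := ub2 (f x2 v1) (imageP _ Yv1).
have := sum_lipschitzl fK Yv1 Xx1 Xx2.
by rewrite ler_norml => /andP[_]; lra.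
Qed.

Lemma min_over_lipschitz (R : realType) (d1 d2 : nat)
    (X : set 'rV[R]_d1) (Y : set 'rV[R]_d2) (K : R) f :
  0 <= K -> compact X -> X !=set0 -> sum_lipschitz X Y K f ->
  forall y1 y2, Y y1 -> Y y2 ->
  `|min_over X (f^~ y1) - min_over X (f^~ y2)| <= K * l2norm (y1 - y2).
Proof.
move=> K0 cX X0 fK.
wlog suff main : / forall y1 y2, Y y1 -> Y y2 ->
    min_over X (f^~ y1) - min_over X (f^~ y2) <= K * l2norm (y1 - y2).
  move=> y1 y2 Yy1 Yy2; rewrite ler_norml main // andbT lerNl opprB l2normB.
  exact: main.
move=> y1 y2 Yy1 Yy2.
have minP y : Y y -> _ := fun Yy => min_overP X0 cX
  (l2_lipschitz_within_continuous K0 (sum_lipschitzl fK Yy)).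
have [[u2 Xu2 <-] _] := minP _ Yy2.
have [_ lb1] := minP _ Yy1.
have := lb1 (f u2 y1) (imageP _ Xu2).
have := sum_lipschitzr fK Xu2 Yy1 Yy2.
by rewrite ler_norml => /andP[_]; lra.
Qed.

(** This is [regularized] for squared norms with [c] equal to [eta^-1]. A sum of t such games is
    again a [ridge], with t c in place of c. *)
Definition ridge (R : realType) (d1 d2 : nat) (c : R)
    (g : 'rV[R]_d1 -> 'rV[R]_d2 -> R) (u : 'rV[R]_d1) (v : 'rV[R]_d2) : R :=
  g u v + c * l2norm u ^+ 2 - c * l2norm v ^+ 2.

Lemma ridge_lipschitz (R : realType) (d1 d2 : nat)
    (X : set 'rV[R]_d1) (Y : set 'rV[R]_d2) (D c K : R) g :
  (forall u, X u -> l2norm u <= D) -> (forall v, Y v -> l2norm v <= D) ->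
  0 <= c -> sum_lipschitz X Y K g ->
  sum_lipschitz X Y (K + 2 * D * c) (ridge c g).
Proof.
move=> XD YD c0 gK x1 y1 x2 y2 Xx1 Yy1 Xx2 Yy2.
have hx := sqr_l2norm_lipschitz (XD _ Xx1) (XD _ Xx2).
have hy := sqr_l2norm_lipschitz (YD _ Yy1) (YD _ Yy2).
have hg := gK _ _ _ _ Xx1 Yy1 Xx2 Yy2.
have {}hx := ler_wpM2l c0 hx; have {}hy := ler_wpM2l c0 hy.
rewrite /ridge.
have -> : g x1 y1 + c * l2norm x1 ^+ 2 - c * l2norm y1 ^+ 2
    - (g x2 y2 + c * l2norm x2 ^+ 2 - c * l2norm y2 ^+ 2)
  = g x1 y1 - g x2 y2 + c * (l2norm x1 ^+ 2 - l2norm x2 ^+ 2)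
    - c * (l2norm y1 ^+ 2 - l2norm y2 ^+ 2) by ring.
apply: le_trans (ler_normB _ _) _.
apply: le_trans (lerD (ler_normD _ _) (lexx _)) _.
rewrite !normrM (ger0_norm c0); lra.
Qed.

(** For fixed [b] the penalty on [b] is a constant, so [strongly_convex_argmin] applies to g(.,
    b). *)
Lemma ridge_argmin_gap (R : realType) (d1 d2 : nat)
    (X : set 'rV[R]_d1) (Y : set 'rV[R]_d2) (c : R) g a b :
  convex_set X -> convex_concave X Y g -> Y b ->
  argmin X (fun u => ridge c g u b) a ->
  forall u, X u ->
  c / 2 * l2norm (u - a) ^+ 2 <= ridge c g u b - ridge c g a b.
Proof.
move=> cX [gx _] Yb [Xa amin] u Xu.
have := @strongly_convex_argmin _ _ _ _ c a cX (gx b Yb) _ u Xu.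
rewrite /ridge => h; apply: le_trans (h _) _; last by lra.
by split=> // w Xw; have := amin w Xw; rewrite /ridge; lra.
Qed.

Lemma ridge_argmax_gap (R : realType) (d1 d2 : nat)
    (X : set 'rV[R]_d1) (Y : set 'rV[R]_d2) (c : R) g a b :
  convex_set Y -> convex_concave X Y g -> X a ->
  argmax Y (fun v => ridge c g a v) b ->
  forall v, Y v ->
  c / 2 * l2norm (v - b) ^+ 2 <= ridge c g a b - ridge c g a v.
Proof.
move=> cY [_ gy] Xa [Yb bmax] v Yv.
have := @strongly_convex_argmin _ _ _ _ c b cY (gy a Xa) _ v Yv.
rewrite /ridge => h; apply: le_trans (h _) _; last by lra.
by split=> // w Yw; have := bmax w Yw; rewrite /ridge; lra.
Qed.

Lemma ridge_concave (R : realType) (d1 d2 : nat)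
    (X : set 'rV[R]_d1) (Y : set 'rV[R]_d2) (c t : R) g u v w :
  convex_concave X Y g -> 0 <= c -> X u -> 0 <= t -> t <= 1 -> Y v -> Y w ->
  t * ridge c g u v + (1 - t) * ridge c g u w
  <= ridge c g u (t *: v + (1 - t) *: w).
Proof.
move=> [_ gy] c0 Xu t0 t1 Yv Yw.
have := convex_function_conv (gy u Xu) t0 t1 Yv Yw.
rewrite /ridge sqr_l2norm_conv.
have : 0 <= c * (t * (1 - t) * l2norm (v - w) ^+ 2).
  by rewrite !mulr_ge0 ?l2norm_ge0 ?subr_ge0.
by rewrite /=; lra.
Qed.

(* Move [b] slightly towards [v]: by strong convexity the minimizer of the
   perturbed problem stays close to [a], so [f a v <= f a b] in the limit. *)
Lemma ridge_maximin_saddle (R : realType) (d1 d2 : nat)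
    (X : set 'rV[R]_d1) (Y : set 'rV[R]_d2) (c K : R) g a b :
  convex_set X -> compact X -> convex_set Y ->
  0 < c -> 0 <= K -> convex_concave X Y g -> sum_lipschitz X Y K (ridge c g) ->
  argmin X (fun u => ridge c g u b) a ->
  argmax Y (fun v => min_over X (fun u => ridge c g u v)) b ->
  saddle_point X Y (ridge c g) a b.
Proof.
move=> cX kX cY c0 K0 ccg fK amin [Yb bmax]; split=> //.
have Xa := amin.1; split=> // v Yv.
have minP y : Y y -> _ := fun Yy => min_overP (ex_intro _ a Xa) kX
  (l2_lipschitz_within_continuous K0 (sum_lipschitzl fK Yy)).
have mb : min_over X (fun u => ridge c g u b) = ridge c g a b.
  have [[u Xu ub] lb] := minP _ Yb; apply/le_anti.
  rewrite (lb _ (imageP (fun u => ridge c g u b) Xa)) /= -ub.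
  exact: amin.2.
have [//|e_gt0] := leP (ridge c g a v) (ridge c g a b).
pose e := ridge c g a v - ridge c g a b.
have e0 : 0 < e by rewrite subr_gt0.
pose m := min_over X (fun u => ridge c g u v); pose B := ridge c g a b - m.
have B0 : 0 <= B by rewrite /B subr_ge0 /m -mb; exact: bmax.
(* The weight [t] below satisfies [4 K^2 B t < c e^2], which contradicts
   [e <= K |u - a|] and [c |u - a|^2 <= 4 t B]. *)
pose q := 2 * c * e ^+ 2 + 8 * K ^+ 2 * B.
have ce0 : 0 < c * e ^+ 2 by rewrite mulr_gt0 // exprn_gt0.
have KB0 : 0 <= K ^+ 2 * B by rewrite mulr_ge0 // sqr_ge0.
have q0 : 0 < q by rewrite /q; lra.
pose t := c * e ^+ 2 / q.
have tq : t * q = c * e ^+ 2 by rewrite /t divfK // gt_eqF.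
have t0 : 0 < t by rewrite divr_gt0.
(* Ensured by the summand 2 c e^2 of [q]. *)
have t12 : t <= 2^-1 by rewrite /t ler_pdivrMr // /q; lra.
have t1 : t <= 1 by lra.
have Yw := convex_set_conv cY (ltW t0) t1 Yv Yb.
set w := _ + _ in Yw.
have [[u Xu um] _] := minP w Yw.
have h1 := bmax w Yw; rewrite mb -um in h1.
have h2 := ridge_concave ccg (ltW c0) Xu (ltW t0) t1 Yv Yb.
have h3 := ridge_argmin_gap cX ccg Yb amin Xu.
have h4 : m <= ridge c g u v.
  by have [_ lb] := minP v Yv; exact: lb (imageP (fun u => ridge c g u v) Xu).
(* With f the ridge game, f(u, w) <= f(a, b) <= f(u, b) and concavity force f(u, v) <= f(a, b),
   hence e <= f(a, v) - f(u, v). *)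
have h5 : e <= K * l2norm (u - a).
  have := sum_lipschitzl fK Yv Xu Xa; rewrite ler_norml => /andP[h _].
  have : t * ridge c g u v <= t * ridge c g a b.
    have := mulr_ge0 (ltW c0) (sqr_ge0 (l2norm (u - a))).
    by rewrite -/w in h2; nra.
  by rewrite ler_pM2l // /e; lra.
(* The same chain, now keeping the gap f(u, b) - f(a, b), weighted by 1 - t >= 1/2. *)
have {h1 h2 h3} h6 : c * l2norm (u - a) ^+ 2 <= 4 * t * B.
  have h := mulr_ge0 (ltW c0) (sqr_ge0 (l2norm (u - a))).
  have s1 : 0 <= 1 - t by lra.
  have := ler_wpM2l s1 h3; have := ler_wpM2l (ltW t0) h4.
  have : 2^-1 * (c * l2norm (u - a) ^+ 2)
      <= (1 - t) * (c * l2norm (u - a) ^+ 2).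
    by rewrite ler_wpM2r //; lra.
  by rewrite -/w in h2; rewrite /B; lra.
have h7 : e ^+ 2 <= K ^+ 2 * l2norm (u - a) ^+ 2.
  by rewrite -exprMn lerXn2r ?nnegrE ?(ltW e0) // mulr_ge0 ?l2norm_ge0.
have := ler_wpM2l (ltW c0) h7; have := ler_wpM2l (sqr_ge0 K) h6.
by move: tq; rewrite /q; have := mulr_gt0 t0 ce0; lra.
Qed.

(** The algorithm picks its two coordinates by separate problems; this couples them. If a' minimizes
    f(., b), then (a', b) is a saddle point, so f(a, b) <= max f(a, .) <= max f(a', .) = f(a', b),
    and strong convexity forces a = a'. *)
Lemma ridge_minimax_saddle (R : realType) (d1 d2 : nat)
    (X : set 'rV[R]_d1) (Y : set 'rV[R]_d2) (c K : R) g a b :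
  convex_set X -> compact X -> convex_set Y -> compact Y ->
  0 < c -> 0 <= K -> convex_concave X Y g -> sum_lipschitz X Y K (ridge c g) ->
  argmin X (fun u => max_over Y (fun v => ridge c g u v)) a ->
  argmax Y (fun v => min_over X (fun u => ridge c g u v)) b ->
  saddle_point X Y (ridge c g) a b.
Proof.
move=> cX kX cY kY c0 K0 ccg fK [Xa aopt] bopt; have Yb := bopt.1.
have maxP u : X u -> _ := fun Xu => max_overP (ex_intro _ b Yb) kY
  (l2_lipschitz_within_continuous K0 (sum_lipschitzr fK Xu)).
have [[a' Xa' a'min] lb] := min_overP (ex_intro _ a Xa) kX
  (l2_lipschitz_within_continuous K0 (sum_lipschitzl fK Yb)).
have amin : argmin X (fun u => ridge c g u b) a'.
  by split=> // u Xu; rewrite a'min; exact: lb (imageP _ Xu).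
have sad := ridge_maximin_saddle cX kX cY c0 K0 ccg fK amin bopt.
have [[v Yv vmax] _] := maxP _ Xa'; have [_ ub] := maxP _ Xa.
have gap := ridge_argmin_gap cX ccg Yb amin Xa.
have h1 := aopt a' Xa'; rewrite /= -vmax in h1.
have h2 := ub _ (imageP _ Yb).
have h3 := sad.2.2 _ Yv.
suff -> : a = a' by [].
have d0 : l2norm (a - a') ^+ 2 <= 0.
  rewrite -(pmulr_rle0 _ c0); lra.
apply/eqP; rewrite -subr_eq0; apply/eqP/l2norm_eq0/eqP.
by rewrite -sqrf_eq0 eq_le d0 sqr_ge0.
Qed.

(** Compactness gives a maximin [b] and then a best reply [a] to it. This supplies the leader after
    the last round, which the algorithm does not compute. *)
Lemma ridge_saddle_exists (R : realType) (d1 d2 : nat)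
    (X : set 'rV[R]_d1) (Y : set 'rV[R]_d2) (c K : R) g :
  convex_set X -> compact X -> X !=set0 ->
  convex_set Y -> compact Y -> Y !=set0 ->
  0 < c -> 0 <= K -> convex_concave X Y g -> sum_lipschitz X Y K (ridge c g) ->
  exists a b, saddle_point X Y (ridge c g) a b.
Proof.
move=> cX kX X0 cY kY Y0 c0 K0 ccg fK.
have [[b Yb bE] ub] := max_overP Y0 kY
  (l2_lipschitz_within_continuous K0 (min_over_lipschitz K0 kX X0 fK)).
have [[a Xa aE] lb] := min_overP X0 kX
  (l2_lipschitz_within_continuous K0 (sum_lipschitzl fK Yb)).
exists a, b; apply: (ridge_maximin_saddle (K := K)) => //.
  by split=> // u Xu; rewrite aE; exact: lb (imageP _ Xu).
by split=> // v Yv; rewrite bE; exact: ub (imageP _ Yv).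
Qed.

(** * Cumulative convex-concave Lipschitz games *)

Lemma convex_concave_sum (R : realType) (d1 d2 : nat)
    (X : set 'rV[R]_d1) (Y : set 'rV[R]_d2)
    (L : nat -> 'rV[R]_d1 -> 'rV[R]_d2 -> R) (n : nat) :
  (forall t, (1 <= t <= n)%N -> convex_concave X Y (L t)) ->
  convex_concave X Y (fun u v => \sum_(1 <= t < n.+1) L t u v).
Proof.
move=> ccL; split=> [v Yv t a b Xa Xb|u Xu t a b Ya Yb];
  rewrite convRE -?sumrN !mulr_sumr -big_split /=; apply: ler_sum_nat => s sn.
  have [h _] := ccL s sn; exact: h.
have [_ h] := ccL s sn; exact: h.
Qed.

Lemma sum_lipschitz_sum (R : realType) (d1 d2 : nat)
    (X : set 'rV[R]_d1) (Y : set 'rV[R]_d2) (K : R)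
    (L : nat -> 'rV[R]_d1 -> 'rV[R]_d2 -> R) (n : nat) :
  (forall t, (1 <= t <= n)%N -> sum_lipschitz X Y K (L t)) ->
  sum_lipschitz X Y (n%:R * K) (fun u v => \sum_(1 <= t < n.+1) L t u v).
Proof.
move=> LK x1 y1 x2 y2 Xx1 Yy1 Xx2 Yy2; rewrite -sumrB.
apply: le_trans (ler_norm_sum _ _ _) _.
have -> : n%:R * K * (l2norm (x1 - x2) + l2norm (y1 - y2))
  = \sum_(1 <= t < n.+1) K * (l2norm (x1 - x2) + l2norm (y1 - y2)).
  by rewrite sumr_const_nat subn1 /= -[RHS]mulr_natl mulrA.
by apply: ler_sum_nat => t tn; exact: LK.
Qed.

Lemma l2_lipschitz_sum_lipschitz (R : realType) (d1 d2 : nat)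
    (X : set 'rV[R]_d1) (Y : set 'rV[R]_d2) (G : R) L :
  0 <= G -> l2_lipschitz X Y G L -> sum_lipschitz X Y G L.
Proof.
move=> G0 LG x1 y1 x2 y2 Xx1 Yy1 Xx2 Yy2.
apply: le_trans (LG _ _ _ _ Xx1 Yy1 Xx2 Yy2) _; rewrite ler_wpM2l //.
by rewrite opp_row_mx add_row_mx l2norm_row_mx_le.
Qed.

(** * Regret *)

(* The be-the-leader argument, with the two players moving alternately. *)
Lemma saddle_telescope (R : realType) (T U : Type) (X : set T) (Y : set U)
    (L : nat -> T -> U -> R) (x : nat -> T) (y : nat -> U) (n : nat) :
  X (x 1%N) -> Y (y 1%N) ->
  (forall t, (1 <= t <= n)%N -> saddle_point X Y
    (fun u v => \sum_(1 <= s < t.+1) L s u v) (x t.+1) (y t.+1)) ->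
  \sum_(1 <= t < n.+1) L t (x t.+1) (y t)
  <= \sum_(1 <= t < n.+1) L t (x n.+1) (y n.+1)
  <= \sum_(1 <= t < n.+1) L t (x t) (y t.+1).
Proof.
move=> Xx1 Yy1 sad.
have {}sad t : (t <= n)%N -> saddle_point X Y
    (fun u v => \sum_(1 <= s < t.+1) L s u v) (x t.+1) (y t.+1).
  case: t => [_|t tn]; last exact: sad.
  (* The arbitrary first iterate is a saddle point of the empty sum. *)
  by split; split=> // ? _ /=; rewrite !big_geq.
elim: n sad => [_|n IH sad]; first by rewrite !big_geq // lexx.
have /andP[IHl IHr] := IH (fun t tn => sad t (leqW tn)).
have [[Xn xn] [Yn yn]] := sad n (leqnSn n).
have [[Xn1 xn1] [Yn1 yn1]] := sad n.+1 (leqnn _).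
have := xn _ Xn1; have := yn _ Yn1; have := xn1 _ Xn; have := yn1 _ Yn.
(* Lower bound: F_n(x_{n+1}, y_{n+1}) <= F_n(x_{n+2}, y_{n+1}); add L_{n+1}(x_{n+2}, y_{n+1}), then
   F_{n+1} grows when y moves to y_{n+2}. The upper bound moves y first. *)
rewrite !(@big_nat_recr _ _ _ n.+1 1) //=; lra.
Qed.

(** With F the ridge game and p, q the two displacements, adding both gaps gives c/2 (p^2 + q^2) <=
    F(a, b') - F(a', b). Since f(a, b') <= f(a, b) <= f(a', b), the right side is at most L(a, b') -
    L(a', b) <= K (p + q); finally (p + q)^2 <= 2 (p^2 + q^2). *)
Lemma ridge_saddle_stability (R : realType) (d1 d2 : nat)
    (X : set 'rV[R]_d1) (Y : set 'rV[R]_d2) (c K : R) g f L a b a' b' :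
  convex_set X -> convex_set Y -> 0 < c -> 0 <= K -> convex_concave X Y g ->
  sum_lipschitz X Y K L ->
  (forall u v, ridge c g u v = f u v + L u v) ->
  saddle_point X Y f a b -> saddle_point X Y (ridge c g) a' b' ->
  l2norm (a - a') + l2norm (b - b') <= 4 * K / c.
Proof.
move=> cX cY c0 K0 ccg LK fE [[Xa amin] [Yb bmax]] [sx sy].
have [Xa' a'min] := sx; have [Yb' b'max] := sy.
have h1 := ridge_argmin_gap cX ccg Yb' sx Xa.
have h2 := ridge_argmax_gap cY ccg Xa' sy Yb.
have h3 := amin _ Xa'; have h4 := bmax _ Yb'.
have := LK _ _ _ _ Xa Yb' Xa' Yb; rewrite ler_norml (l2normB b') => /andP[_].
have := fE a b'; have := fE a' b.
move: (l2norm_ge0 (a - a')) (l2norm_ge0 (b - b')) h1 h2 h3 h4.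
move: (l2norm (a - a')) (l2norm (b - b')) => p q p0 q0 h1 h2 h3 h4 E1 E2 h5.
have [->|pq0] := eqVneq (p + q) 0.
  by rewrite divr_ge0 ?mulr_ge0 // ltW.
have {}pq0 : 0 < p + q by rewrite lt0r pq0 addr_ge0.
rewrite ler_pdivlMr // -(ler_pM2r pq0).
have := mulr_ge0 (ltW c0) (sqr_ge0 (p - q)); lra.
Qed.

(** Telescoping 1/(k+1) <= ln(k+1) - ln k, which is ln(1+x) <= x at x = -1/(k+1), bounds the sum by
    1 + ln n. The case k = 1 reads 1/2 <= ln 2, so 1 <= 2 ln n. *)
Lemma harmonic_le_ln (R : realType) (n : nat) : (2 <= n)%N ->
  \sum_(1 <= t < n.+1) (t%:R^-1 : R) <= 3 * ln n%:R.
Proof.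
have step k : (1 <= k)%N -> k.+1%:R^-1 <= ln k.+1%:R - ln k%:R :> R.
  move=> k1; have k0 : 0 < k%:R :> R by rewrite ltr0n.
  have := @le_ln1Dx R (- k.+1%:R^-1).
  have -> : 1 + - k.+1%:R^-1 = k%:R / k.+1%:R :> R.
    by rewrite -natr1; field; rewrite natr1 pnatr_eq0.
  rewrite ln_div ?posrE ?ltr0n // => h; rewrite lerNr opprB in h.
  apply: h; rewrite ltrN2 invf_lt1 ?ltr0n // ltr1n; lia.
have main k : (1 <= k)%N -> \sum_(1 <= t < k.+1) (t%:R^-1 : R) <= 1 + ln k%:R.
  elim: k => // -[_ _|k IH _]; first by rewrite big_nat1 ln1 addr0 invr1.
  have := lerD (IH isT) (step k.+1 isT).
  by rewrite -addrA subrKC => h; rewrite big_nat_recr //=; exact: h.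
move=> n2; have := main n (ltnW n2).
have := step 1%N isT; rewrite ln1 subr0.
have : ln 2 <= ln n%:R :> R by rewrite ler_ln ?posrE ?ltr0n ?ler_nat; lia.
lra.
Qed.

Lemma ridge_sum (R : realType) (d1 d2 : nat) (c : R)
    (L : nat -> 'rV[R]_d1 -> 'rV[R]_d2 -> R) (n : nat) u v :
  \sum_(1 <= t < n.+1) ridge c (L t) u v
  = ridge (n%:R * c) (fun u v => \sum_(1 <= t < n.+1) L t u v) u v.
Proof.
rewrite sumrB big_split /= !sumr_const_nat subn1 /=.
by rewrite /ridge -!mulrA !mulr_natl.
Qed.

(** The two penalties lie in [0, c D^2] and enter with opposite signs, so their errors do not add
    up. *)
Lemma ridge_close (R : realType) (d1 d2 : nat) (D c : R)
    (g : 'rV[R]_d1 -> 'rV[R]_d2 -> R) u v :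
  0 <= c -> l2norm u <= D -> l2norm v <= D ->
  `|ridge c g u v - g u v| <= c * D ^+ 2.
Proof.
move=> c0 uD vD.
have sq d (w : 'rV[R]_d) : l2norm w <= D ->
    0 <= c * l2norm w ^+ 2 /\ c * l2norm w ^+ 2 <= c * D ^+ 2.
  move=> wD; rewrite mulr_ge0 ?sqr_ge0 // ler_wpM2l //.
  by rewrite lerXn2r ?nnegrE ?l2norm_ge0 // (le_trans (l2norm_ge0 w)).
have [q1 q2] := sq _ _ uD; have [q3 q4] := sq _ _ vD.
by rewrite /ridge ler_norml; apply/andP; split; lra.
Qed.

(** For the upper bound compare [a] with a minimax [u] of [g]; for the lower bound compare [b] with
    a best reply [v] to [a] in [g]. *)
Lemma ridge_saddle_value (R : realType) (d1 d2 : nat)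
    (X : set 'rV[R]_d1) (Y : set 'rV[R]_d2) (D c K : R) g a b :
  compact X -> compact Y ->
  (forall u, X u -> l2norm u <= D) -> (forall v, Y v -> l2norm v <= D) ->
  0 <= c -> 0 <= K -> sum_lipschitz X Y K g ->
  saddle_point X Y (ridge c g) a b ->
  `|ridge c g a b - min_over X (fun u => max_over Y (fun v => g u v))|
  <= c * D ^+ 2.
Proof.
move=> kX kY XD YD c0 K0 gK [[Xa amin] [Yb bmax]].
have maxP u : X u -> _ := fun Xu => max_overP (ex_intro _ b Yb) kY
  (l2_lipschitz_within_continuous K0 (sum_lipschitzr gK Xu)).
have [[u Xu um] lb] := min_overP (ex_intro _ a Xa) kX
  (l2_lipschitz_within_continuous K0
    (max_over_lipschitz K0 kY (ex_intro _ b Yb) gK)).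
have [_ ub] := maxP _ Xu; have [[v Yv vm] _] := maxP _ Xa.
have h1 := ub _ (imageP _ Yb); have h2 := lb _ (imageP _ Xa).
rewrite -vm /= in h2; rewrite um in h1.
have h3 := amin _ Xu; have h4 := bmax _ Yv.
have := ridge_close g c0 (XD _ Xu) (YD _ Yb).
have := ridge_close g c0 (XD _ Xa) (YD _ Yv).
rewrite !ler_norml => /andP[l1 r1] /andP[l2 r2].
by apply/andP; split; lra.
Qed.

(** The harmonic term is the cost of playing one round late. The penalty T c D^2 is paid twice:
    along the iterates and in the saddle value. *)
Lemma ridge_leader_regret (R : realType) (d1 d2 : nat)
    (X : set 'rV[R]_d1) (Y : set 'rV[R]_d2) (D G c : R) (T : nat)
    (L : nat -> 'rV[R]_d1 -> 'rV[R]_d2 -> R)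
    (x : nat -> 'rV[R]_d1) (y : nat -> 'rV[R]_d2) :
  convex_set X -> compact X -> convex_set Y -> compact Y ->
  (forall u, X u -> l2norm u <= D) -> (forall v, Y v -> l2norm v <= D) ->
  0 <= D -> 0 <= G -> 0 < c ->
  (forall t, (1 <= t <= T)%N ->
    convex_concave X Y (L t) /\ sum_lipschitz X Y G (L t)) ->
  X (x 1%N) -> Y (y 1%N) -> (0 < T)%N ->
  (forall t, (1 <= t < T)%N -> saddle_point X Y
    (fun u v => \sum_(1 <= s < t.+1) ridge c (L s) u v) (x t.+1) (y t.+1)) ->
  `|\sum_(1 <= t < T.+1) L t (x t) (y t)
    - min_over X (fun u => max_over Y (fun v => \sum_(1 <= t < T.+1) L t u v))|
  <= 4 * (G + 2 * D * c) ^+ 2 / c * \sum_(1 <= t < T.+1) (t%:R^-1 : R)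
    + 2 * (T%:R * c * D ^+ 2).
Proof.
move=> cX kX cY kY XD YD D0 G0 c0 hL Xx1 Yy1 T0 sad.
set K := G + 2 * D * c.
have K0 : 0 <= K by rewrite /K addr_ge0 // !mulr_ge0 // ltW.
have sumE t : (fun u v => \sum_(1 <= s < t.+1) ridge c (L s) u v)
    = ridge (t%:R * c) (fun u v => \sum_(1 <= s < t.+1) L s u v).
  by apply/funext => u; apply/funext => v; rewrite ridge_sum.
have tc0 t : (0 < t)%N -> 0 < t%:R * c by move=> ?; rewrite mulr_gt0 // ltr0n.
have LK t : (1 <= t <= T)%N -> sum_lipschitz X Y K (ridge c (L t)).
  by move=> /hL[_ LG]; exact: ridge_lipschitz (ltW c0) LG.
have ccS t : (t <= T)%N ->
    convex_concave X Y (fun u v => \sum_(1 <= s < t.+1) L s u v).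
  by move=> tT; apply: convex_concave_sum => s st; apply: (hL _ _).1; lia.
have SG t : (t <= T)%N ->
    sum_lipschitz X Y (t%:R * G) (fun u v => \sum_(1 <= s < t.+1) L s u v).
  by move=> tT; apply: sum_lipschitz_sum => s st; apply: (hL _ _).2; lia.
have [a [b sadT]] : exists a b, saddle_point X Y
    (fun u v => \sum_(1 <= s < T.+1) ridge c (L s) u v) a b.
  rewrite sumE.
  apply: (ridge_saddle_exists (K := T%:R * G + 2 * D * (T%:R * c))) => //;
    [by exists (x 1%N) | by exists (y 1%N) | exact: tc0 | | exact: ccS |].
    by rewrite addr_ge0 // !mulr_ge0 // ltW.
  by apply: ridge_lipschitz; rewrite ?ltW ?tc0 //; exact: SG.
(* The telescoping needs a leader at T + 1; the values of [x] and [y] there are unconstrained, so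
   they are overwritten by the saddle point (a, b). *)
pose x' t := if t == T.+1 then a else x t.
pose y' t := if t == T.+1 then b else y t.
have x'E t : (t <= T)%N -> x' t = x t.
  by move=> tT; rewrite /x' ltn_eqF.
have y'E t : (t <= T)%N -> y' t = y t.
  by move=> tT; rewrite /y' ltn_eqF.
have Xx'1 : X (x' 1%N) by rewrite x'E.
have Yy'1 : Y (y' 1%N) by rewrite y'E.
have {}sad t : (1 <= t <= T)%N -> saddle_point X Y
    (fun u v => \sum_(1 <= s < t.+1) ridge c (L s) u v) (x' t.+1) (y' t.+1).
  move=> /andP[t1]; rewrite leq_eqVlt => /orP[/eqP ->|tT].
    by rewrite /x' /y' eqxx.
  by rewrite x'E // y'E //; apply: sad; rewrite t1.
have Xx' t : (1 <= t <= T.+1)%N -> X (x' t).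
  by case: t => // -[//|t] tT; have [[]] := sad t.+1 tT.
have Yy' t : (1 <= t <= T.+1)%N -> Y (y' t).
  by case: t => // -[//|t] tT; have [_ []] := sad t.+1 tT.
have /andP[lo hi] := saddle_telescope Xx'1 Yy'1 sad.
have val := ridge_saddle_value kX kY XD YD (ltW (tc0 _ T0))
  (mulr_ge0 (ler0n _ T) G0) (SG T (leqnn T)).
move: (sad T); rewrite T0 leqnn sumE => /(_ isT) /val {}val.
rewrite -ridge_sum /= in val.
have stab t : (1 <= t <= T)%N ->
    l2norm (x' t - x' t.+1) + l2norm (y' t - y' t.+1) <= 4 * K / c * t%:R^-1.
  move=> tT; have [t1 tT'] := andP tT.
  have -> : 4 * K / c * t%:R^-1 = 4 * K / (t%:R * c).
    by rewrite invfM -!mulrA [c^-1 * _]mulrC.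
  apply: (@ridge_saddle_stability _ _ _ X Y _ K
    (fun u v => \sum_(1 <= s < t.+1) L s u v)
    (fun u v => \sum_(1 <= s < t) ridge c (L s) u v) (ridge c (L t))) => //.
  - exact: tc0.
  - exact: ccS.
  - exact: LK.
  - by move=> u v; rewrite -ridge_sum big_nat_recr.
  (* For t = 1 the previous game is the empty sum. *)
  - case: t tT t1 tT' => // -[|t] tT t1 tT'; last by apply: sad; lia.
    by split; split=> // ? _ /=; rewrite !big_geq.
  - by rewrite -sumE; exact: sad.
set H := \sum_(1 <= t < T.+1) (t%:R^-1 : R).
have K2 t p q : p + q <= 4 * K / c * t%:R^-1 -> 0 <= p -> 0 <= q ->
    K * p <= 4 * K ^+ 2 / c * t%:R^-1 /\ K * q <= 4 * K ^+ 2 / c * t%:R^-1.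
  move=> pq p0 q0.
  have -> : 4 * K ^+ 2 / c * t%:R^-1 = K * (4 * K / c * t%:R^-1) by ring.
  by split; apply: ler_wpM2l => //; lra.
(* Replacing one coordinate by its successor costs K times its displacement, that is 4 K^2 / (t
   c). *)
have stepl t : (1 <= t < T.+1)%N ->
    ridge c (L t) (x' t) (y' t) - 4 * K ^+ 2 / c * t%:R^-1
    <= ridge c (L t) (x' t.+1) (y' t).
  move=> tT; have [h _] := K2 _ _ _ (stab t tT) (l2norm_ge0 _) (l2norm_ge0 _).
  have Xt : X (x' t) by apply: Xx'; lia.
  have Xt1 : X (x' t.+1) by apply: Xx'; lia.
  have Yt : Y (y' t) by apply: Yy'; lia.
  have := sum_lipschitzl (LK t tT) Yt Xt Xt1; rewrite ler_norml => /andP[_].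
  lra.
have stepr t : (1 <= t < T.+1)%N ->
    ridge c (L t) (x' t) (y' t.+1)
    <= ridge c (L t) (x' t) (y' t) + 4 * K ^+ 2 / c * t%:R^-1.
  move=> tT; have [_ h] := K2 _ _ _ (stab t tT) (l2norm_ge0 _) (l2norm_ge0 _).
  have Xt : X (x' t) by apply: Xx'; lia.
  have Yt : Y (y' t) by apply: Yy'; lia.
  have Yt1 : Y (y' t.+1) by apply: Yy'; lia.
  have := sum_lipschitzr (LK t tT) Xt Yt Yt1; rewrite ler_norml => /andP[+ _].
  lra.
have regl : \sum_(1 <= t < T.+1) ridge c (L t) (x' t) (y' t)
    - 4 * K ^+ 2 / c * H
    <= \sum_(1 <= t < T.+1) ridge c (L t) (x' t.+1) (y' t).
  by rewrite /H mulr_sumr -sumrB; exact: ler_sum_nat.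
have regr : \sum_(1 <= t < T.+1) ridge c (L t) (x' t) (y' t.+1)
    <= \sum_(1 <= t < T.+1) ridge c (L t) (x' t) (y' t)
      + 4 * K ^+ 2 / c * H.
  by rewrite /H mulr_sumr -big_split; exact: ler_sum_nat.
have pen : `|\sum_(1 <= t < T.+1) ridge c (L t) (x' t) (y' t)
    - \sum_(1 <= t < T.+1) L t (x t) (y t)| <= T%:R * c * D ^+ 2.
  rewrite -sumrB; apply: le_trans (ler_norm_sum _ _ _) _.
  have -> : T%:R * c * D ^+ 2 = \sum_(1 <= t < T.+1) c * D ^+ 2.
    by rewrite sumr_const_nat subn1 /= -[RHS]mulr_natl mulrA.
  apply: ler_sum_nat => t /andP[t1 tT]; rewrite -x'E // -y'E //.
  apply: ridge_close; first exact: ltW.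
    by apply/XD/Xx'; rewrite t1 leqW.
  by apply/YD/Yy'; rewrite t1 leqW.
move: val pen; rewrite !ler_norml => /andP[v1 v2] /andP[p1 p2].
by apply/andP; split; lra.
Qed.

(** * Tuning the regularization *)

Theorem corollary1 (R : realType) :
  exists C : R,
  forall (d1 d2 : nat) (X : set 'rV[R]_d1) (Y : set 'rV[R]_d2) (D G : R)
    (T : nat) (Lbar : nat -> 'rV[R]_d1 -> 'rV[R]_d2 -> R)
    (x : nat -> 'rV[R]_d1) (y : nat -> 'rV[R]_d2),
  convex_set X -> compact X -> X 0 ->
  convex_set Y -> compact Y -> Y 0 ->
  0 < D ->
  (forall u, X u -> l2norm u <= D) ->
  (forall v, Y v -> l2norm v <= D) ->
  (2 <= T)%N ->
  0 < G ->
  (forall t : nat, (1 <= t <= T)%N ->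
    convex_concave X Y (Lbar t) /\ l2_lipschitz X Y G (Lbar t)) ->
  let eta := D * Num.sqrt T%:R / (G * Num.sqrt (ln T%:R)) in
  sp_rftl X Y eta (fun u => l2norm u ^+ 2) (fun v => l2norm v ^+ 2) T Lbar x y ->
  `|\sum_(1 <= t < T.+1) Lbar t (x t) (y t)
    - min_over X (fun u => max_over Y (fun v =>
        \sum_(1 <= t < T.+1) Lbar t u v))|
  <= C * G * D * Num.sqrt (T%:R * ln T%:R).
Proof.
(* 110 = 4 * 9 * 3 + 2: stability factor 4, K^2 <= 9 G^2, harmonic sum at most 3 ln T, and two
   penalties. *)
exists 110 => d1 d2 X Y D G T L x y cX kX X0 cY kY Y0 D0 XD YD T2 G0 hL.
set s := Num.sqrt T%:R; set l := Num.sqrt (ln T%:R).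
move=> eta [Xx1 Yy1 alg].
have T0 : 0 < T%:R :> R by rewrite ltr0n; lia.
(* T >= 2 makes ln T, and hence [eta], positive. *)
have lnT0 : 0 < ln T%:R :> R by rewrite ln_gt0 // ltr1n.
have s0 : 0 < s by rewrite sqrtr_gt0.
have l0 : 0 < l by rewrite sqrtr_gt0.
have ls : l <= s by rewrite ler_sqrt ?ltW // ln_sublinear.
have s2 : s ^+ 2 = T%:R by rewrite sqr_sqrtr // ltW.
have l2 : l ^+ 2 = ln T%:R by rewrite sqr_sqrtr // ltW.
have eta0 : 0 < eta by rewrite divr_gt0 // mulr_gt0.
have c0 : 0 < eta^-1 by rewrite invr_gt0.
have {}hL t : (1 <= t <= T)%N ->
    convex_concave X Y (L t) /\ sum_lipschitz X Y G (L t).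
  move=> /hL[ccL LG]; split=> //.
  exact: l2_lipschitz_sum_lipschitz (ltW G0) LG.
have sad t : (1 <= t < T)%N -> saddle_point X Y
    (fun u v => \sum_(1 <= s < t.+1) ridge eta^-1 (L s) u v)
    (x t.+1) (y t.+1).
  move=> tT; have [hx hy] := alg t tT.
  have sumE : (fun u v => \sum_(1 <= s < t.+1) ridge eta^-1 (L s) u v)
      = ridge (t%:R * eta^-1) (fun u v => \sum_(1 <= s < t.+1) L s u v).
    by apply/funext => u; apply/funext => v; rewrite ridge_sum.
  have tc0 : 0 < t%:R * eta^-1 by rewrite mulr_gt0 // ltr0n; lia.
  rewrite sumE.
  apply: (@ridge_minimax_saddle _ _ _ _ _ _
    (t%:R * G + 2 * D * (t%:R * eta^-1))) => //.
  - by rewrite addr_ge0 // !mulr_ge0 // ltW.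
  - by apply: convex_concave_sum => k kt; apply: (hL _ _).1; lia.
  - apply: ridge_lipschitz => //; first exact: ltW.
    by apply: sum_lipschitz_sum => k kt; apply: (hL _ _).2; lia.
  - by rewrite -sumE.
  - by rewrite -sumE.
apply: le_trans (ridge_leader_regret cX kX cY kY XD YD (ltW D0) (ltW G0) c0 hL
  Xx1 Yy1 (ltnW T2) sad) _.
have etaV : eta^-1 = G * l / (D * s) by rewrite invf_div.
(* 2 D / eta = 2 G sqrt(ln T / T), and ln T <= T. *)
have K3 : G + 2 * D * eta^-1 <= 3 * G.
  have -> : 2 * D * eta^-1 = 2 * G * (l / s).
    by rewrite etaV; field; rewrite !gt_eqF.
  have : l / s <= 1 by rewrite ler_pdivrMr // mul1r.
  nra.
have K0 : 0 <= G + 2 * D * eta^-1 by rewrite addr_ge0 ?mulr_ge0 // ltW.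
have KK : (G + 2 * D * eta^-1) ^+ 2 <= 9 * G ^+ 2 by nra.
rewrite (sqrtrM _ (ltW T0)) -/s -/l.
have -> : 2 * (T%:R * eta^-1 * D ^+ 2) = 2 * (G * D * (s * l)).
  by rewrite -s2 etaV; field; rewrite !gt_eqF.
have -> : 110 * G * D * (s * l)
    = 108 * (G * D * (s * l)) + 2 * (G * D * (s * l)).
  by ring.
rewrite lerD2r.
have -> : 108 * (G * D * (s * l))
    = 4 * (9 * G ^+ 2) / eta^-1 * (3 * ln T%:R).
  by rewrite -l2 etaV; field; rewrite !gt_eqF.
apply: ler_pM.
- by rewrite divr_ge0 ?mulr_ge0 ?sqr_ge0 // ltW.
- by apply: sumr_ge0 => t _; rewrite invr_ge0.
- by rewrite ler_wpM2r ?ler_wpM2l // ltW // invr_gt0.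
- exact: harmonic_le_ln.
Qed.
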